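(* Let $(G,\Gamma)$ be an almost semisimple graph structure, and let $H<G$ be a subgroup. If $(G,\Gamma)$ is growth quasitight relative to $H$, then it is thick relative to $H$.
   Context: A graph structure $(G,\Gamma)$ consists of a countable group $G$ and a finite directed graph $\Gamma$ such that (a) $\Gamma$ has an initial vertex $v_0$ from which every other vertex can be reached by a directed path; (b) every edge is labeled by an element of $G$, and distinct edges directed out of a fixed vertex have distinct labels. The evaluation map $\mathrm{ev}$ sends a finite path to the product of its edge labels. $\Omega_0$ is the set of finite paths starting at $v_0$, $S_n\subset\Omega_0$ the set of those of length $n$, and $P^n(A)=\#(S_n\cap A)/\#S_n$ for $A\subseteq\Omega_0$. The structure is almost semisimple (of growth $\lambda$) if there are $c>0$, $\lambda>1$ with $c^{-1}\lambda^n\le\#S_n\le c\lambda^n$ for all $n$. Irreducible components of $\Gamma$ are the classes of mutually accessible vertices. A component $C$ is maximal if for some (equivalently any) $v\in C$ the number $a_n$ of paths of length $n$ starting at $v$ and contained in $C$ satisfies $\limsup_n\sqrt[n]{a_n}=\lambda$; a vertex has maximal growth if it lies in a maximal component. The loop semigroup $\Gamma_v\subseteq G$ is the set of evaluations of closed directed paths based at $v$. The structure is thick relative to $H<G$ if for every vertex $v$ of maximal growth there is a finite set $B\subseteq G$ with $H\subseteq B\,\Gamma_v\,B$. A path $\gamma$ in $\Gamma$ $c$-almost contains $w\in G$ if it has a subpath $p$ with $w=a\cdot\mathrm{ev}(p)\cdot b$ in $G$ for some $a,b\in G$ with $|a|,|b|\le c$, where $|\cdot|$ is word length with respect to the finite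 set of edge labels and their inverses. $Y_{w,c}$ is the set of paths in $\Omega_0$ which do not $c$-almost contain $w$. The structure is growth quasitight relative to $H<G$ if there is $c>0$ such that for every $w\in H$, $P^n(Y_{w,c})\to0$ as $n\to\infty$. *)

(* Defs.v *)
From mathcomp Require Import all_boot all_order all_algebra.
From mathcomp Require Import all_classical all_reals all_analysis.

Set Implicit Arguments.
Unset Strict Implicit.
Unset Printing Implicit Defensive.

Import Order.TTheory GRing.Theory Num.Theory.
Import numFieldNormedType.Exports.

Local Open Scope classical_set_scope.
Local Open Scope ring_scope.

Definition adjacent (V E : finType) (src tgt : E -> V) : rel V :=
  fun u v => [exists e, (src e == u) && (tgt e == v)].

(* Parallel edges are allowed, provided that they have different labels. *)
Record graph_structure (G : groupType) := GraphStructure {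
  vertex : finType;
  edge : finType;
  src : edge -> vertex;
  tgt : edge -> vertex;
  label : edge -> G;
  init : vertex;
  init_reach : forall v, connect (adjacent src tgt) init v;
  label_inj : forall e f, src e = src f -> label e = label f -> e = f
}.

Section GraphStructure.
Variables (G : groupType) (Gamma : graph_structure G).

Local Notation V := (vertex Gamma).
Local Notation E := (edge Gamma).
Local Notation adj := (adjacent (@src G Gamma) (@tgt G Gamma)).

(* A finite directed path is represented by its starting vertex together with
   its sequence of edges; the empty sequence is the path of length 0. *)
Fixpoint is_path (v : V) (p : seq E) : bool :=
  if p is e :: p' then (src e == v) && is_path (tgt e) p' else true.

Definition path_end (v : V) (p : seq E) : V := last v (map (@tgt G Gamma) p).

Definition ev (p : seq E) : G := (\prod_(e <- p) label e)%g.

Definition Omega0 : set (seq E) := [set p | is_path (init Gamma) p].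

Definition sphere (n : nat) : {set n.-tuple E} :=
  [set p : n.-tuple E | is_path (init Gamma) p]%SET.

Definition mutually_accessible : rel V :=
  fun u v => connect adj u v && connect adj v u.

Definition irreducible_components : {set {set V}} :=
  equivalence_partition mutually_accessible [set: V]%SET.

Definition paths_in (C : {set V}) (v : V) (n : nat) : {set n.-tuple E} :=
  [set p : n.-tuple E | is_path v p &
     all (fun u => u \in C) (v :: map (@tgt G Gamma) p)]%SET.

Definition loop_semigroup (v : V) : set G :=
  [set ev p | p in [set p | is_path v p /\ path_end v p = v]].

Definition letter : set G :=
  [set g | exists e : E, g = label e \/ g = (label e)^-1%g].

Variable R : realType.

Definition Pn (n : nat) (A : set (seq E)) : R :=
  #|[set p in sphere n | (p : seq E) \in A]%SET|%:R / #|sphere n|%:R.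

Definition almost_semisimple (lambda : R) : Prop :=
  exists c : R, [/\ 0 < c, 1 < lambda &
    forall n, c^-1 * lambda ^+ n <= #|sphere n|%:R <= c * lambda ^+ n].

Definition maximal_component (lambda : R) (C : {set V}) : Prop :=
  C \in irreducible_components /\
  exists2 v, v \in C &
    limn_esup (fun n => ((#|paths_in C v n|%:R : R) `^ n%:R^-1)%:E) = lambda%:E.

Definition maximal_growth (lambda : R) (v : V) : Prop :=
  exists2 C, maximal_component lambda C & v \in C.

Definition thick (lambda : R) (H : set G) : Prop :=
  forall v, maximal_growth lambda v ->
  exists2 B : set G, finite_set B &
    forall h, H h -> exists b g b',
      [/\ B b, loop_semigroup v g, B b' & h = (b * g * b')%g].

(* The infimum is +oo when g is not in the subgroup generated by the labels. *)
Definition word_length (g : G) : \bar R :=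
  ereal_inf [set ((size s)%:R)%:E | s in
    [set s : seq G | (forall x, x \in s -> letter x) /\ g = (\prod_(x <- s) x)%g]].

Definition almost_contains (c : R) (p : seq E) (w : G) : Prop :=
  exists q a b, [/\ infix q p, w = (a * ev q * b)%g,
    (word_length a <= c%:E)%E & (word_length b <= c%:E)%E].

Definition Yset (w : G) (c : R) : set (seq E) :=
  [set p | Omega0 p /\ ~ almost_contains c p w].

Definition growth_quasitight (H : set G) : Prop :=
  exists2 c : R, 0 < c &
    forall w, H w -> Pn n (Yset w c) @[n --> \oo] --> (0 : R).

End GraphStructure.

(* Main.v *)
Require Import Defs.
From mathcomp Require Import all_boot all_order all_algebra.
From mathcomp Require Import all_classical all_reals all_analysis.
From mathcomp Require Import lra.

Set Implicit Arguments.
Unset Strict Implicit.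
Unset Printing Implicit Defensive.

Import Order.TTheory GRing.Theory Num.Theory.
Import numFieldNormedType.Exports.

Local Open Scope classical_set_scope.
Local Open Scope ring_scope.

(** Let C be a maximal component containing v, and let A_n be the number of
    paths of length n in C with an arbitrary starting vertex in C.  Cutting a
    path in two shows that A_(m+n) <= A_m A_n, so that lambda, which is the
    upper growth rate of the paths in C from one vertex, is a lower bound for
    the n-th root of A_n at every n, and not only along a subsequence
    ([submultiplicative_growth]).  Hence for each n > 0 some vertex u of C
    starts at least lambda^n / #|V| paths of length n in C.  Prefix these by a
    path beta of length at most #|V| from the initial vertex to u.  As the
    spheres have at most c lambda^n elements, the resulting paths make up a
    proportion of the sphere containing them which is bounded below
    independently of n.

    Quasitightness makes the proportion of paths that miss a given h in H
    tend to 0, so some beta ++ p, with p a path in C, almost contains h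
    ([maximal_component_path_notin]): h = x ev(q) y with q a subpath and x, y
    short.  Now q is a piece of beta followed by a subpath q2 of p, and both
    ends of q2 lie in C.  Irreducibility provides paths l from v to the start
    of q2 and r from the end of q2 to v, of length at most #|V|, and
    l ++ q2 ++ r is a loop at v.  Therefore h is the evaluation of this loop,
    multiplied on each side by an element whose word length is bounded
    independently of h, and the finite set B can be taken to be a ball of the
    word metric. *)

(** * Growth rates of submultiplicative sequences *)

Section UpperGrowthRate.
Variable R : realType.

Lemma lt_limn_esup_frequently (u : nat -> \bar R) (x : \bar R) :
  (x < limn_esup u)%E -> forall N, exists2 n, (N <= n)%N & (x < u n)%E.
Proof.
move=> xu N.
have : (x < ereal_sup [set u n | n in [set n | (N <= n)%N]])%E.
  apply: lt_le_trans xu _; apply: ereal_inf_lbound.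
  by exists [set n | (N <= n)%N] => //; exact: nbhs_infty_ge.
by move=> /ereal_sup_gt[_ [n /= Nn <-] xun]; exists n.
Qed.

(** A strict bound on x by lambda ^ m is witnessed by a rate strictly smaller
    than lambda: take the m-th root of a number between x and lambda ^ m. *)
Lemma exprn_gap (lambda x : R) m : (0 < m)%N -> 1 < lambda ->
  x < lambda ^+ m -> exists mu, [/\ 1 <= mu, mu < lambda & x < mu ^+ m].
Proof.
move=> m0 l1 xl.
(* The maximum with 1 forces the root to be at least 1. *)
pose z := (Num.max 1 x + lambda ^+ m) / 2.
have l1m : 1 < lambda ^+ m by rewrite exprn_egt1 // -lt0n.
have y1 : 1 <= Num.max 1 x by rewrite le_max lexx.
have yx : x <= Num.max 1 x by rewrite le_max lexx orbT.
have yl : Num.max 1 x < lambda ^+ m by rewrite gt_max l1m.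
have [zy zl] : Num.max 1 x < z /\ z < lambda ^+ m by rewrite /z; split; lra.
have z0 : 0 <= z by lra.
have zm : (z `^ m%:R^-1) ^+ m = z.
  rewrite -powR_mulrn ?powR_ge0// -powRrM mulVf ?powRr1//.
  by rewrite pnatr_eq0 -lt0n.
exists (z `^ m%:R^-1); rewrite zm; split; last lra.
- rewrite leNgt; apply/negP => lt1.
  have : (z `^ m%:R^-1) ^+ m <= 1 by apply: exprn_ile1 => //; rewrite ?powR_ge0 ?ltW.
  by rewrite zm; lra.
- rewrite ltNge; apply/negP => lt1.
  have : lambda ^+ m <= (z `^ m%:R^-1) ^+ m.
    by rewrite lerXn2r// nnegrE ?powR_ge0//; lra.
  by rewrite zm; lra.
Qed.

Lemma expr_dominates (x y K : R) : 0 <= x -> x < y -> 1 <= y ->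
  exists q0, forall q, (q0 <= q)%N -> K * x ^+ q < y ^+ q.
Proof.
move=> x0 xy y1.
have y0 : 0 < y by lra.
have : K * (x / y) ^+ n @[n --> \oo] --> K * 0.
  apply: cvgMr; apply: cvg_expr.
  by rewrite ger0_norm ?divr_ge0 ?(ltW y0)// ltr_pdivrMr// mul1r.
rewrite mulr0 => /cvgr_lt/(_ 1 ltr01)[q0 _ hq]; exists q0 => q /hq /=.
by rewrite expr_div_n mulrA ltr_pdivrMr ?exprn_gt0// mul1r.
Qed.

(** The half of Fekete's lemma used for counting: if A m were less than
    lambda ^ m, then it would be less than mu ^ m for some mu < lambda.
    Writing n = q m + r, submultiplicativity bounds A n by a constant times
    (A m) ^ q, whereas a n, hence A n, exceeds mu ^ n >= (mu ^ m) ^ q for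
    arbitrarily large n. *)
Lemma submultiplicative_growth (lambda : R) (a A : nat -> nat) :
  1 < lambda -> (forall n, (a n <= A n)%N) ->
  (forall m n, (A (m + n) <= A m * A n)%N) ->
  limn_esup (fun n => (((a n)%:R : R) `^ n%:R^-1)%:E) = lambda%:E ->
  forall m, (0 < m)%N -> lambda ^+ m <= (A m)%:R.
Proof.
move=> l1 aA AM alim m m0; rewrite leNgt; apply/negP => Alt.
have [mu [mu1 mul Amu]] := exprn_gap m0 l1 Alt.
(* K bounds A r uniformly over the possible remainders r of n modulo m. *)
pose K := (\sum_(r < m) A r)%N.
have AK n : (A n <= K * A m ^ (n %/ m))%N.
  have AM' q r : (A (q * m + r) <= A r * A m ^ q)%N.
    elim: q => [|q IH]; first by rewrite mul0n add0n expn0 muln1.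
    rewrite mulSn -addnA; apply: leq_trans (AM _ _) _.
    by rewrite expnS mulnCA leq_mul2l IH orbT.
  rewrite {1}(divn_eq n m); apply: leq_trans (AM' _ _) _.
  rewrite leq_mul2r; apply/orP; right.
  by rewrite /K (bigD1 (Ordinal (ltn_pmod n m0)))//= leq_addr.
have mum1 : 1 <= mu ^+ m by rewrite exprn_ege1.
have [q0 hq0] := expr_dominates K%:R (ler0n R (A m)) Amu mum1.
have mulim : (mu%:E < limn_esup (fun n => (((a n)%:R : R) `^ n%:R^-1)%:E))%E.
  by rewrite alim lte_fin.
have [n nge] := lt_limn_esup_frequently mulim (q0 * m).+1.
rewrite lte_fin => mun.
have n0 : (0 < n)%N by exact: leq_trans nge.
have mua : mu ^+ n <= (a n)%:R.
  have -> : (a n)%:R = ((a n)%:R `^ n%:R^-1) ^+ n :> R.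
    rewrite -powR_mulrn ?powR_ge0// -powRrM mulVf ?powRr1//.
    by rewrite pnatr_eq0 -lt0n.
  by rewrite lerXn2r// ?nnegrE ?powR_ge0//; lra.
have q0n : (q0 <= n %/ m)%N by rewrite leq_divRL// ltnW.
have /lt_geF := hq0 _ q0n; rewrite -exprM.
have -> // : mu ^+ (m * (n %/ m)) <= K%:R * (A m)%:R ^+ (n %/ m).
apply: (@le_trans _ _ (mu ^+ n)).
  by rewrite ler_weXn2l// mulnC leq_divM.
apply: le_trans mua _; rewrite -natrX -natrM ler_nat.
exact: leq_trans (aA n) (AK n).
Qed.

End UpperGrowthRate.

(** * Balls of the word metric *)

Section WordBall.
Variables (G : groupType) (Gamma : graph_structure G).

(** Membership is stated by an explicit word rather than through
    [word_length], whose infimum over the extended reals is inconvenient for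
    products. *)
Definition word_ball (N : nat) : set G :=
  [set g | exists s : seq G, [/\ forall x, x \in s -> letter Gamma x,
     (size s <= N)%N & g = (\prod_(x <- s) x)%g]].

Lemma word_ballM M N g h :
  word_ball M g -> word_ball N h -> word_ball (M + N) (g * h)%g.
Proof.
move=> [s [sl sM ->]] [t [tl tN ->]]; exists (s ++ t).
rewrite size_cat big_cat leq_add//; split=> // x.
by rewrite mem_cat => /orP[/sl|/tl].
Qed.

Lemma letterV g : letter Gamma g -> letter Gamma g^-1%g.
Proof. by move=> [e [->|->]]; exists e; [right|left; rewrite invgK]. Qed.

Lemma word_ballV N g : word_ball N g -> word_ball N g^-1%g.
Proof.
move=> [s [sl sN ->]]; exists (rev [seq x^-1%g | x <- s]); split.
- by move=> x; rewrite mem_rev => /mapP[y /sl yl ->]; exact: letterV.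
- by rewrite size_rev size_map.
elim: s {sl sN} => [|x s IH]; first by rewrite !big_nil invg1.
by rewrite big_cons invgM IH /= rev_cons -cats1 big_cat big_seq1.
Qed.

Lemma le_word_ball M N g : (M <= N)%N -> word_ball M g -> word_ball N g.
Proof. by move=> MN [s [sl sM ->]]; exists s; split=> //; exact: leq_trans MN. Qed.

Lemma word_ball_ev (p : seq (edge Gamma)) : word_ball (size p) (ev p).
Proof.
exists [seq label e | e <- p]; rewrite size_map big_map; split=> //.
by move=> x /mapP[e _ ->]; exists e; left.
Qed.

Lemma finite_word_ball N : finite_set (word_ball N).
Proof.
pose lt (x : edge Gamma * bool) : G :=
  if x.2 then label x.1 else (label x.1)^-1%g.
pose f (s : N.-bseq (edge Gamma * bool)) : G := (\prod_(x <- s) lt x)%g.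
apply: (@sub_finite_set _ _ (range f)); last exact: finite_image.
move=> _ [s [sl sN ->]].
have [t st] : exists t, s = map lt t.
  elim: s sl {sN} => [|x s IH] sl; first by exists [::].
  have [t ->] : exists t, s = map lt t.
    by apply: IH => y ys; apply: sl; rewrite inE ys orbT.
  by have [e [] ->] := sl _ (mem_head x s);
    [exists ((e, true) :: t)|exists ((e, false) :: t)].
have tN : (size t <= N)%N by rewrite -(size_map lt) -st.
by exists (Bseq tN) => //; rewrite st /f big_map.
Qed.

(** An infimum that is at most c provides a word of length less than any
    given number exceeding c; the radius is an integer of this kind. *)
Lemma word_length_ball (R : realType) (c : R) g :
  (word_length Gamma R g <= c%:E)%E -> word_ball (Num.trunc c).+1 g.
Proof.
move=> gc.
have : (word_length Gamma R g < ((Num.trunc c).+1%:R)%:E)%E.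
  by apply: le_lt_trans gc _; rewrite lte_fin truncnS_gt.
move=> /ereal_inf_lt[_ [s [sl ->] <-]]; rewrite lte_fin ltr_nat => sN.
by exists s; split=> //; exact: ltnW.
Qed.

End WordBall.

(** * Paths and irreducible components *)

Section Paths.
Variables (G : groupType) (Gamma : graph_structure G).
Local Notation V := (vertex Gamma).
Local Notation E := (edge Gamma).
Local Notation adj := (Defs.adjacent (@src G Gamma) (@tgt G Gamma)).

Lemma path_end_cat (v : V) (p q : seq E) :
  path_end v (p ++ q) = path_end (path_end v p) q.
Proof. by rewrite /path_end map_cat last_cat. Qed.

Lemma is_path_cat (v : V) (p q : seq E) :
  is_path v (p ++ q) = is_path v p && is_path (path_end v p) q.
Proof. by elim: p v => //= e p IH v; rewrite IH andbA. Qed.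

Lemma ev_cat (p q : seq E) : ev (p ++ q) = (ev p * ev q)%g.
Proof. exact: big_cat. Qed.

Lemma connect_short_path (u v : V) : connect adj u v ->
  exists p : seq E, [/\ is_path u p, path_end u p = v & (size p <= #|V|)%N].
Proof.
move=> /connectP[s0 us0 ->]; case: (shortenP us0) => s us uniqs _.
have sz : (size s <= #|V|)%N.
  by have := max_card (mem (u :: s)); rewrite (card_uniqP uniqs) => /ltnW.
suff [p [up pv szp]] : exists p : seq E,
    [/\ is_path u p, path_end u p = last u s & size p = size s].
  by exists p; rewrite szp.
elim: s u us {us0 uniqs sz} => [|w s IH] u /=; first by exists [::].
move=> /andP[/existsP[e /andP[/eqP eu /eqP ew]] /IH[p [wp pw szp]]].
by exists (e :: p); rewrite /= eu eqxx ew szp /path_end /= ew.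
Qed.

Lemma component_connect (C : {set V}) (u v : V) :
  C \in irreducible_components Gamma -> u \in C -> v \in C -> connect adj u v.
Proof.
move=> CP uC vC.
have eqv : {in [set: V]%SET & &, equivalence_rel (@mutually_accessible G Gamma)}.
  move=> x y z _ _ _; split=> [|/andP[xy yx]]; first exact/andP.
  apply/andP/andP => -[h1 h2]; split;
    by [exact: connect_trans h1|exact: connect_trans h2 _].
have /and3P[_ tI _] := equivalence_partitionP eqv.
have := pblock_equivalence_partition eqv (finset.in_setT u) (finset.in_setT v).
by rewrite (def_pblock tI CP uC) vC => /esym/andP[].
Qed.

(** Summing over all starting vertices of C is what makes the count
    submultiplicative: a path cut at time m resumes at an arbitrary vertex
    of C. *)
Definition component_count (C : {set V}) (n : nat) : nat :=
  (\sum_(u in C) #|paths_in C u n|)%N.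

Lemma mem_paths_in (C : {set V}) u n (p : n.-tuple E) :
  (p \in paths_in C u n) = is_path u p &&
    all (fun w => w \in C) (u :: map (@tgt G Gamma) p).
Proof. by rewrite finset.inE. Qed.

Lemma paths_in_end (C : {set V}) u (p q : seq E) :
  all (fun w => w \in C) (u :: map (@tgt G Gamma) (p ++ q)) ->
  path_end u p \in C.
Proof.
rewrite map_cat -cat_cons all_cat => /andP[/allP h _].
exact: h (mem_last _ _).
Qed.

Lemma leq_paths_in_cat (C : {set V}) u m n :
  (#|paths_in C u (m + n)| <= #|paths_in C u m| * component_count C n)%N.
Proof.
pose B := (\bigcup_(w in C) paths_in C w n)%SET.
have cardB : (#|B| <= component_count C n)%N.
  rewrite /B /component_count.
  elim/big_rec2: _ => [|w k S _ IH]; first by rewrite cards0.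
  by rewrite (leq_trans (leq_card_setU _ _))// leq_add2l.
apply: leq_trans (leq_mul (leqnn _) cardB).
rewrite -cardsX.
pose f (x : m.-tuple E * n.-tuple E) : (m + n).-tuple E :=
  [tuple of x.1 ++ x.2].
apply: leq_trans (leq_imset_card f _); apply: subset_leq_card.
apply/fintype.subsetP => p; rewrite mem_paths_in => /andP[pp pC].
have sz1 : size (take m p) == m by rewrite size_takel// size_tuple leq_addr.
have sz2 : size (drop m p) == n by rewrite size_drop size_tuple addKn.
apply/imsetP; exists (Tuple sz1, Tuple sz2); last first.
  by apply: val_inj; rewrite /= cat_take_drop.
rewrite -(cat_take_drop m p) in pp pC.
have eC := paths_in_end pC.
move: pp pC; rewrite is_path_cat map_cat -cat_cons all_cat.
move=> /andP[p1 p2] /andP[C1 C2].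
rewrite finset.inE /= mem_paths_in p1 C1 /=.
apply/bigcupP; exists (path_end u (take m p)) => //.
by rewrite mem_paths_in p2 /= eC C2.
Qed.

Lemma component_count_submul (C : {set V}) m n :
  (component_count C (m + n) <= component_count C m * component_count C n)%N.
Proof.
by rewrite {1 2}/component_count big_distrl; apply: leq_sum => u _;
  exact: leq_paths_in_cat.
Qed.

(** The starting vertex u depends on n.  By submultiplicativity the total
    count is at least lambda ^ n, and u is given by the pigeonhole
    principle. *)
Lemma component_growth (R : realType) (lambda : R) (C : {set V}) n :
  1 < lambda -> maximal_component lambda C -> (0 < n)%N ->
  exists2 u, u \in C & lambda ^+ n / #|V|%:R <= #|paths_in C u n|%:R.
Proof.
move=> l1 [_ [v vC vlim]] n0.
have V0 : (0 < #|V|)%N by apply/card_gt0P; exists v.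
have an k : (#|paths_in C v k| <= component_count C k)%N.
  by rewrite /component_count (bigD1 v)//= leq_addr.
have := submultiplicative_growth l1 an (component_count_submul C) vlim n0.
move=> lA; apply: contrapT => no.
have : (component_count C n)%:R < lambda ^+ n.
  rewrite /component_count natr_sum.
  have le0 : 0 <= lambda ^+ n / #|V|%:R.
    by rewrite divr_ge0// exprn_ge0//; lra.
  apply: (@lt_le_trans _ _ (\sum_(u in C) lambda ^+ n / #|V|%:R)).
    apply: ltr_sum; first by apply/hasP; exists v; rewrite // mem_index_enum.
    by move=> u uC; rewrite ltNge; apply/negP => h; apply: no; exists u.
  rewrite sumr_const -[leLHS]mulr_natr -mulrA ler_piMr ?exprn_ge0//; first lra.
  by rewrite mulrC ler_pdivrMr ?ltr0n// mul1r ler_nat max_card.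
by rewrite ltNge lA.
Qed.

(** A subpath may straddle the junction of two paths; only its part in the
    second one is kept track of, the other part being short. *)
Lemma infix_cat_split (T : eqType) (q s t : seq T) : infix q (s ++ t) ->
  exists q1 q2, [/\ q = q1 ++ q2, (size q1 <= size s)%N & infix q2 t].
Proof.
elim: s q => [|x s IH] q; first by move=> h; exists [::], q.
rewrite cat_cons infix_consl -cat_cons => /orP[/prefixP[r e]|/IH[q1 [q2 [-> h1 h2]]]].
  exists (take (size (x :: s)) q), (drop (size (x :: s)) q).
  rewrite cat_take_drop size_take_min geq_minl; split=> //.
  have -> : t = drop (size (x :: s)) (q ++ r) by rewrite -e drop_size_cat.
  rewrite drop_cat; case: ltnP => [_|le]; first by apply/infixP; exists [::], r.
  by rewrite drop_oversize// infix0s.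
by exists q1, q2; split=> //; exact: leqW.
Qed.

Lemma Pn_ge (R : realType) (n : nat) (Y : set (seq E)) (S : {set n.-tuple E}) :
  (forall p, p \in S -> is_path (init Gamma) p /\ Y p) ->
  #|S|%:R / #|sphere Gamma n|%:R <= Pn R n Y.
Proof.
move=> SY; rewrite /Pn ler_wpM2r ?invr_ge0// ler_nat.
apply: subset_leq_card; apply/fintype.subsetP => p /SY[pp Yp].
by rewrite !finset.inE pp; apply/mem_set.
Qed.

(** A set of asymptotic density 0 cannot contain all the paths that reach a
    maximal component by a short path and then stay in it, because these have
    positive upper density. *)
Lemma maximal_component_path_notin (R : realType) (lambda : R) (C : {set V})
    (Y : set (seq E)) :
  almost_semisimple Gamma lambda -> maximal_component lambda C ->
  Pn R n Y @[n --> \oo] --> (0 : R) ->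
  exists (b p : seq E) (u : V), [/\ (size b <= #|V|)%N,
    is_path (init Gamma) (b ++ p) /\ ~ Y (b ++ p),
    path_end (init Gamma) b = u & all (fun w => w \in C) (u :: map (@tgt G Gamma) p)].
Proof.
move=> [c [c0 l1 hc]] Cmax Ylim.
have V0 : (0 < #|V|)%N by apply/card_gt0P; exists (init Gamma).
(* There are at least lambda ^ n / #|V| of these paths, in a sphere of radius
   at most n + #|V|, hence of size at most c lambda ^ (n + #|V|). *)
pose eps : R := (#|V|%:R * (c * lambda ^+ #|V|))^-1.
have l0 : 0 < lambda by lra.
have eps0 : 0 < eps by rewrite invr_gt0 !mulr_gt0 ?ltr0n// exprn_gt0.
move: Ylim => /cvgr_lt/(_ _ eps0)[N _ hN].
have [u uC un] := component_growth l1 Cmax (ltn0Sn N).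
have [b [bp bu bV]] := connect_short_path (init_reach u).
apply: contrapT => no.
pose f (p : N.+1.-tuple E) : (size b + N.+1).-tuple E := [tuple of in_tuple b ++ p].
have f_inj : injective f.
  move=> p q /(congr1 val) /= /eqP; rewrite eqseq_cat// eqxx /= => /eqP.
  exact: val_inj.
have PY : Pn R (size b + N.+1) Y < eps.
  by apply: hN; rewrite /= (leq_trans (leqnSn _))// leq_addl.
suff : eps <= Pn R (size b + N.+1) Y by rewrite leNgt PY.
have SY : forall p, p \in [set f p | p in paths_in C u N.+1]%SET ->
    is_path (init Gamma) p /\ Y p.
  move=> _ /imsetP[p pP ->].
  move: pP; rewrite mem_paths_in => /andP[pp pC].
  have bpp : is_path (init Gamma) (b ++ p) by rewrite is_path_cat bp bu.
  split=> //=; apply: contrapT => nY; apply: no.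
  by exists b, p, u.
apply: le_trans (Pn_ge R SY); rewrite card_imset//.
have /andP[s1 s2] := hc (size b + N.+1)%N.
have S0 : 0 < #|sphere Gamma (size b + N.+1)|%:R :> R.
  by apply: lt_le_trans s1; rewrite mulr_gt0 ?invr_gt0// exprn_gt0.
rewrite ler_pdivlMr//.
apply: le_trans un.
apply: le_trans (ler_wpM2l (ltW eps0) s2) _.
have Vr : (0:R) < #|V|%:R by rewrite ltr0n.
have lV : 0 < lambda ^+ #|V| by rewrite exprn_gt0.
rewrite /eps mulrC ler_pdivrMr ?mulr_gt0//.
rewrite [leRHS]mulrA divfK ?gt_eqF// [leRHS]mulrCA ler_wpM2l ?(ltW c0)//.
by rewrite -exprD addnC ler_weXn2l ?ltW// leq_add2l.
Qed.

End Paths.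

Theorem proposition7p2 (R : realType) (G : groupType)
    (hG : countable [set: G]) (Gamma : graph_structure G)
    (lambda : R) (hGamma : almost_semisimple Gamma lambda)
    (H : set G) (hH : group_closed (G := G) (mem H)) :
  growth_quasitight Gamma R H -> thick Gamma lambda H.
Proof.
move=> [c c0 qt] v [C Cmax vC].
(* The summands bound the word lengths of x, of the piece of beta and of l. *)
pose N := ((Num.trunc c).+1 + #|vertex Gamma| + #|vertex Gamma|)%N.
exists (word_ball Gamma N); first exact: finite_word_ball.
move=> h Hh.
have [b [p [u [bV [bp nY bu pC]]]]] :=
  maximal_component_path_notin hGamma Cmax (qt h Hh).
have [q [x [y [qp -> xc yc]]]] : almost_contains c (b ++ p) h.
  by apply: contrapT => na; apply: nY.
have [q1 [q2 [-> q1b /infixP[s [t pE]]]]] := infix_cat_split qp.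
have [CP _] := Cmax.
move: bp; rewrite is_path_cat bu pE !is_path_cat => /and4P[_ _ q2p _].
have w1C : path_end u s \in C.
  by apply: (@paths_in_end _ _ _ _ _ (q2 ++ t));
  rewrite -pE; exact: pC.
have w2C : path_end (path_end u s) q2 \in C.
  by rewrite -path_end_cat; apply: (@paths_in_end _ _ _ _ _ t);
    rewrite -catA -pE; exact: pC.
have [l [lp lw lV]] := connect_short_path (component_connect CP vC w1C).
have [r [rp rw rV]] := connect_short_path (component_connect CP w2C vC).
exists (x * ev q1 * (ev l)^-1)%g, (ev (l ++ q2 ++ r)), ((ev r)^-1 * y)%g; split.
- apply: word_ballM; last first.
    by apply: word_ballV; apply: le_word_ball lV _; exact: word_ball_ev.
  apply: word_ballM; first exact: word_length_ball xc.
  by apply: le_word_ball (word_ball_ev q1); exact: leq_trans bV.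
- exists (l ++ q2 ++ r) => //; split.
    by rewrite !is_path_cat lp lw q2p rp.
  by rewrite !path_end_cat lw rw.
- apply: (@le_word_ball _ _ (#|vertex Gamma| + (Num.trunc c).+1)).
    by rewrite addnC /N leq_addr.
  apply: word_ballM; last exact: word_length_ball yc.
  by apply: word_ballV; apply: le_word_ball rV _; exact: word_ball_ev.
- by rewrite !ev_cat !mulgA mulgVK mulgK.
Qed.
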